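(* Let $K:\mathbb{Z}^2\to[0,\infty)$ satisfy $\sup_{k,l\in\mathbb{Z}}K(k,l)\le C_K$ for some $C_K\in(0,\infty)$. Let $f_0\in\ell_{1,1}(\mathbb{Z})$ be nonnegative and let $f$ be the corresponding solution of $\dot f(t)=Q(f(t))$, $t>0$, $f(0)=f_0$. For $N\in\mathbb{N}$ let $f_N$ be the solution of the truncated problem $\dot f_N(t)=Q^N(f_N(t))$, $t>0$, with initial value $f_N(0)=f_0^N$. Then for every $T>0$, $$\lim_{N\to\infty}\|f_N-f\|_{C^1([0,T],\ell_{1,1}(\mathbb{Z}))}=0.$$
   Context: $\ell_{1,1}(\mathbb{Z})$ is the Banach space of functions $g:\mathbb{Z}\to\mathbb{R}$ with $\|g\|_{1,1}:=\sum_{k\in\mathbb{Z}}(1+|k|)|g(k)|<\infty$. The collision operator associated with a kernel $K$ is $Q(f)=Q(f,f)$, where for $k\in\mathbb{Z}$ $$Q(f,g)(k)=\sum_{l\in\mathbb{Z}}\Big(K(l,k-1)g(l)f(k-1)-K(k,l-1)f(k)g(l-1)-K(l,k)g(l)f(k)+K(k+1,l-1)f(k+1)g(l-1)\Big).$$ Truncation: for $N\in\mathbb{N}$, $S_N:=\{k\in\mathbb{Z}:|k|\le N\}$. For $g:\mathbb{Z}\to\mathbb{R}$, $g^N(k)=g(k)$ if $k\in S_N$ and $g^N(k)=0$ otherwise. The truncated kernel is $K^N(k,l)=K(k,l)$ if $k\in\{-N+1,\dots,N\}$ and $l\in\{-N,\dots,N-1\}$, and $K^N(k,l)=0$ otherwise.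 $Q^N$ is the collision operator associated with $K^N$. For a bounded nonnegative kernel and nonnegative initial value in $\ell_{1,1}(\mathbb{Z})$, the initial value problem for the associated collision operator has a unique global solution in $C^1([0,\infty);\ell_{1,1}(\mathbb{Z}))$, which is nonnegative; ''solution'' refers to this one. *)

(* Defs.v *)
From HB Require Import structures.
From mathcomp Require Import all_boot all_order all_algebra.
From mathcomp Require Import all_classical all_reals all_analysis.

Set Implicit Arguments.
Unset Strict Implicit.
Unset Printing Implicit Defensive.

Import Order.TTheory GRing.Theory Num.Theory.
Import numFieldNormedType.Exports.

Local Open Scope classical_set_scope.
Local Open Scope ring_scope.

Section l11_space.
Variable R : realType.

(* The norm is defined for every g : int -> R, with value +oo when the sum
   diverges. *)
Definition l11_enorm (g : int -> R) : \bar R :=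
  \esum_(k in [set: int]) ((1 + `|k|%:~R) * `|g k|)%:E.

Definition l11_pred : pred (int -> R) := fun g => `[< (l11_enorm g < +oo)%E >].

Record l11 := L11 { l11_fun :> int -> R ; _ : l11_pred l11_fun }.

HB.instance Definition _ := [isSub for l11_fun].
HB.instance Definition _ := [Choice of l11 by <:].

Lemma l11_term_ge0 (g : int -> R) k : 0 <= (1 + `|k|%:~R) * `|g k|.
Proof. by rewrite mulr_ge0// addr_ge0// ler0z. Qed.

Lemma l11_enorm_ge0 g : (0 <= l11_enorm g)%E.
Proof. by apply: esum_ge0 => k _; rewrite lee_fin l11_term_ge0. Qed.

Lemma l11_enorm0 : l11_enorm 0 = 0%E.
Proof. by apply: esum1 => k _; rewrite normr0 mulr0. Qed.

Lemma l11_enormD (g h : int -> R) :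
  (l11_enorm (g + h)%R <= l11_enorm g + l11_enorm h)%E.
Proof.
rewrite /l11_enorm -esumD; [|by move=> k _; rewrite lee_fin l11_term_ge0..].
apply: le_esum => k _; rewrite -EFinD lee_fin -mulrDr.
by apply: ler_wpM2l; [rewrite addr_ge0// ler0z | exact: ler_normD].
Qed.

Lemma l11_enormZ_le (c : R) g :
  (l11_enorm (fun k => c * g k)%R <= `|c|%:E * l11_enorm g)%E.
Proof.
apply: ge_ereal_sup => _ [F [finF _]] <-.
rewrite (eq_fsbigr (fun k => `|c|%:E * ((1 + `|k|%:~R) * `|g k|)%:E)%E); last first.
  by move=> k _; rewrite -EFinM normrM mulrCA.
rewrite -ge0_mule_fsumr; last by move=> k; rewrite lee_fin l11_term_ge0.
rewrite lee_wpmul2l// ?lee_fin//.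
by apply: ereal_sup_ubound; exists F.
Qed.

Lemma l11_enormZ (c : R) g :
  l11_enorm (fun k => c * g k)%R = (`|c|%:E * l11_enorm g)%E.
Proof.
apply/eqP; rewrite eq_le l11_enormZ_le/=.
have [->|c0] := eqVneq c 0; first by rewrite normr0 mul0e l11_enorm_ge0.
have := l11_enormZ_le c^-1 (fun k => c * g k).
rewrite (_ : (fun k => c^-1 * _) = g); last by apply/funext => k; rewrite mulKf.
have c_ge0 : (0 <= `|c|%:E :> \bar R)%E by rewrite lee_fin.
move=> /(lee_wpmul2l c_ge0) /le_trans; apply.
by rewrite muleA -EFinM normfV divff ?normr_eq0// mul1e.
Qed.

Lemma l11_enorm_lty (g : l11) : (l11_enorm g < +oo)%E.
Proof. by case: g => g /= /asboolP. Qed.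

Lemma l11_enorm_fin (g : l11) : l11_enorm g \is a fin_num.
Proof. by rewrite ge0_fin_numE ?l11_enorm_lty// l11_enorm_ge0. Qed.

Lemma l11_zmod_closed : zmod_closed l11_pred.
Proof.
split; first by apply/asboolP; rewrite l11_enorm0.
move=> g h /asboolP gfin /asboolP hfin; apply/asboolP.
apply: le_lt_trans (l11_enormD _ _) _; apply: lte_add_pinfty => //.
rewrite (_ : - h = fun k => -1 * h k); last by apply/funext => k; rewrite mulN1r.
by rewrite l11_enormZ normrN1 mul1e.
Qed.

HB.instance Definition _ := GRing.isZmodClosed.Build _ l11_pred l11_zmod_closed.
HB.instance Definition _ := [SubChoice_isSubZmodule of l11 by <:].

Lemma l11_scale_subproof (c : R) (g : l11) : l11_pred (fun k => c * g k).
Proof. by apply/asboolP; rewrite l11_enormZ lte_mul_pinfty// l11_enorm_lty. Qed.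

Definition l11_scale (c : R) (g : l11) := L11 (l11_scale_subproof c g).

Lemma l11_scaleA a b g : l11_scale a (l11_scale b g) = l11_scale (a * b) g.
Proof. by apply/val_inj/funext => k /=; rewrite mulrA. Qed.

Lemma l11_scale1 : left_id 1 l11_scale.
Proof. by move=> g; apply/val_inj/funext => k /=; rewrite mul1r. Qed.

Lemma l11_scaleDr : right_distributive l11_scale +%R.
Proof. by move=> a g h; apply/val_inj/funext => k /=; rewrite mulrDr. Qed.

Lemma l11_scaleDl g : {morph l11_scale^~ g : a b / a + b}.
Proof. by move=> a b; apply/val_inj/funext => k /=; rewrite mulrDl. Qed.

HB.instance Definition _ := GRing.Zmodule_isLmodule.Build R l11
  l11_scaleA l11_scale1 l11_scaleDr l11_scaleDl.

Definition l11_norm (g : l11) : R := fine (l11_enorm g).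

Lemma l11_normD g h : l11_norm (g + h) <= l11_norm g + l11_norm h.
Proof.
by rewrite -lee_fin EFinD !fineK ?l11_enorm_fin// l11_enormD.
Qed.

Lemma l11_normZ c g : l11_norm (c *: g) = `|c| * l11_norm g.
Proof. by rewrite /l11_norm [l11_enorm _]l11_enormZ fineM// l11_enorm_fin. Qed.

Lemma l11_term_le (g : int -> R) k :
  (((1 + `|k|%:~R) * `|g k|)%:E <= l11_enorm g)%E.
Proof.
apply: ereal_sup_ubound; exists [set k]; first by split.
by rewrite fsbig_set1.
Qed.

Lemma l11_norm_eq0 g : l11_norm g = 0 -> g = 0.
Proof.
move=> g0; apply/val_inj/funext => k /=.
have := l11_term_le g k.
rewrite -[leRHS]fineK ?l11_enorm_fin// -/(l11_norm g) g0 lee_fin.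
rewrite pmulr_rle0 ?normr_le0; first by move/eqP.
by rewrite ltr_pwDl// ler0z.
Qed.

HB.instance Definition _ := @Lmodule_isNormed.Build R l11 l11_norm
  l11_normD l11_normZ l11_norm_eq0.

Lemma l11_coord_le (g : l11) k : `|g k| <= `|g|.
Proof.
have := l11_term_le g k; rewrite -[leRHS]fineK ?l11_enorm_fin// lee_fin.
apply: le_trans; rewrite ler_peMl// lerDl ler0z//.
Qed.

Lemma l11_complete (F : set_system l11) : ProperFilter F -> cauchy F -> cvg F.
Proof.
move=> FF Fc.
have /cauchyP Fex := Fc.
have cvgk k : cvg ((fun h : l11 => h k) @ F).
  apply: cauchy_cvg; apply: cauchy_exP => e e0.
  have [h0 Fh0] := Fex _ e0; exists (h0 k).
  suff : F [set h : l11 | ball (h0 k) e (h k)] by [].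
  apply: filterS Fh0 => h; rewrite -!ball_normE /=.
  by apply: le_lt_trans; exact: (l11_coord_le (h0 - h) k).
pose g k := lim ((fun h : l11 => h k) @ F).
have near_g (h0 : l11) e : F (ball h0 e) ->
    (l11_enorm (fun k => g k - h0 k)%R <= e%:E)%E.
  move=> Fh0; apply: ge_ereal_sup => _ [S [finS _]] <-.
  rewrite fsbig_finite//= sumEFin lee_fin.
  set r := (X in \sum_(k <- X) _).
  pose s (h : l11) : R :=
    \sum_(k <- r) (1 + `|k|%:~R) * `|h k - h0 k|.
  have sF : s @ F --> (\sum_(k <- r) (1 + `|k|%:~R) * `|g k - h0 k| : R).
    apply: cvg_big => [|k _]; first exact: add_continuous.
    apply: cvgMl_tmp; apply: cvg_norm.
    by apply: cvgB; [exact: cvgk | exact: cvg_cst].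
  apply: (cvgr_to_le sF).
  apply: filterS Fh0 => h; rewrite -ball_normE /= distrC => /ltW.
  apply: le_trans; rewrite -lee_fin [leRHS]fineK ?l11_enorm_fin//.
  rewrite -sumEFin -fsbig_finite//.
  by apply: ereal_sup_ubound; exists S.
have g_l11 : l11_pred g.
  have [h0 /near_g gh0] := Fex _ ltr01.
  apply/asboolP; rewrite (_ : g = (fun k => g k - h0 k) + h0); last first.
    by apply/funext => k /=; rewrite subrK.
  apply: le_lt_trans (l11_enormD _ _) _; apply: lte_add_pinfty.
    by apply: le_lt_trans gh0 _; rewrite ltry.
  exact: l11_enorm_lty.
apply/cvg_ex; exists (L11 g_l11); apply/fcvg_ballP => e e0.
have [h0 Fh0] := Fex _ (divr_gt0 e0 (ltr0n R 2)).
have gh0 : `|L11 g_l11 - h0| <= e / 2.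
  by rewrite -lee_fin [leLHS]fineK ?l11_enorm_fin//; exact: near_g.
apply: filterS Fh0 => h; rewrite -!ball_normE /= => h0h.
by rewrite (splitr e) (le_lt_trans (ler_distD h0 _ _))// ler_ltD.
Qed.

HB.instance Definition _ := Uniform_isComplete.Build l11 l11_complete.

End l11_space.

Section derivative_on_a_set.
Variables (R : realType) (V : normedModType R).
Implicit Types (A : set R) (f u : R -> V).

(* Difference quotients are taken within A, so that the derivative is one-sided
   at an endpoint of an interval A. *)
Definition diffq f (t s : R) : V := (s - t)^-1 *: (f s - f t).

Definition derivable_on A f (t : R) : Prop :=
  cvg (diffq f t s @[s --> within A t^']).

Definition derive_on A f (t : R) : V :=
  lim (diffq f t s @[s --> within A t^']).

Definition C1_on A f : Prop :=
  (forall t, A t -> derivable_on A f t) /\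
  {within A, continuous (derive_on A f)}.

(* Valued in the extended reals, as the supremum of an unbounded set of reals
   would be 0 in R. *)
Definition supnorm_on A u : \bar R := ereal_sup [set `|u t|%:E | t in A].

Definition C1norm_on A u : \bar R :=
  (supnorm_on A u + supnorm_on A (derive_on A u))%E.

Lemma derive_on_interior A f t : nbhs t A -> derive_on A f t = f^`()%classic t.
Proof.
move=> At; rewrite /derive_on /derive1 /diffq; congr (lim _).
apply/funext => P.
transitivity (\forall s \near t, s != t -> P ((s - t)^-1 *: (f s - f t))).
  rewrite propeqE; split=> H; first by apply: filterS2 At H => s As Hs st; exact: Hs.
  by apply: filterS H => s Hs st _; exact: Hs.
rewrite (near_shift 0 t) subr0; apply: eq_near => h /=.
by rewrite -[X in _ != X]add0r (inj_eq (addIr _)) addrK.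
Qed.

End derivative_on_a_set.

Section collision.
Variable R : realType.
Implicit Types (K : int -> int -> R) (f g : int -> R).

(* The unordered sum of an absolutely summable family. *)
Definition zsum (u : int -> R) : R :=
  fine (\esum_(l in [set: int]) (EFin \o u)^\+%E l
        - \esum_(l in [set: int]) (EFin \o u)^\-%E l)%E.

Definition collision2 K f g (k : int) : R :=
  zsum (fun l => K l (k - 1) * g l * f (k - 1)
                 - K k (l - 1) * f k * g (l - 1)
                 - K l k * g l * f k
                 + K (k + 1) (l - 1) * f (k + 1) * g (l - 1)).

Definition collision K f : int -> R := collision2 K f f.

Definition truncate (N : nat) g : int -> R :=
  fun k => if `|k| <= N%:Z then g k else 0.

Definition truncate_kernel (N : nat) K : int -> int -> R :=
  fun k l => if (- N%:Z + 1 <= k <= N%:Z) && (- N%:Z <= l <= N%:Z - 1)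
             then K k l else 0.

(* The values of f at negative times are irrelevant. Nonnegativity is not
   required: it holds automatically, by uniqueness, when the kernel is bounded
   and nonnegative and the initial value is nonnegative. *)
Definition is_solution K g (f : R -> l11 R) : Prop :=
  [/\ C1_on `[0, +oo[ f,
      forall t, 0 < t -> derive_on `[0, +oo[ f t = collision K (f t) :> (int -> R)
    & f 0 = g :> (int -> R)].

End collision.

(* Main.v *)
Require Import Defs.
From mathcomp Require Import all_boot all_order all_algebra.
From mathcomp Require Import all_classical all_reals all_analysis.
From mathcomp Require Import ring lra zify.

(* The collision operator is quadratic and locally Lipschitz on l11, uniformly
   in the truncation, since each of its four terms is bounded by a tensor
   product of l11 sequences. Truncating the kernel perturbs it, at f(t), by at
   most a constant times |f(t)| times the norm of the tail of f(t), and these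
   tails are small uniformly in t in [0, T] by compactness.  Hence, as long as
   |f_N - f| <= 1, the difference satisfies |(f_N - f)'| <= L |f_N - f| + e
   with L independent of N and e -> 0.  It therefore stays below
   e exp((L + 1) t): otherwise consider the first time where both are equal
   and compare left derivatives.  For small e this barrier is at most 1 on
   [0, T], so that no a priori bound on f_N is needed. *)

Import Order.TTheory GRing.Theory Num.Theory.
Import numFieldNormedType.Exports.

Local Open Scope classical_set_scope.
Local Open Scope ring_scope.

(** * The space l11 and absolutely convergent sums over the integers *)

Lemma l11_addE (R : realType) (g h : l11 R) k : (g + h) k = g k + h k.
Proof. by []. Qed.

Lemma l11_oppE (R : realType) (g : l11 R) k : (- g) k = - g k.
Proof. by []. Qed.

Lemma l11_scaleE (R : realType) (c : R) (g : l11 R) k : (c *: g) k = c * g k.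
Proof. by []. Qed.

Lemma l11_enormE (R : realType) (g : l11 R) : l11_enorm g = `|g|%:E.
Proof. by rewrite -(fineK (l11_enorm_fin g)). Qed.

Lemma le_l11_enorm (R : realType) (u v : int -> R) :
  (forall k, `|u k| <= `|v k|) -> (l11_enorm u <= l11_enorm v)%E.
Proof.
move=> uv; apply: le_esum => k _; rewrite lee_fin.
by apply: ler_wpM2l; rewrite ?addr_ge0// ler0z.
Qed.

Lemma le_l11_norm (R : realType) (g h : l11 R) :
  (forall k, `|g k| <= `|h k|) -> `|g| <= `|h|.
Proof. by move=> /le_l11_enorm; rewrite !l11_enormE. Qed.

Lemma l11_pred_dominated {R : realType} (h : l11 R) (u : int -> R) :
  (forall k, `|u k| <= `|h k|) -> l11_pred u.
Proof.
by move=> uh; apply/asboolP/(le_lt_trans (le_l11_enorm _ _ _ uh))/l11_enorm_lty.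
Qed.

Lemma esum_abs_le_l11_norm (R : realType) (g : l11 R) :
  (\esum_(k in [set: int]) `|g k|%:E <= `|g|%:E)%E.
Proof.
rewrite -l11_enormE; apply: le_esum => k _.
by rewrite lee_fin ler_peMl// lerDl ler0z.
Qed.

Lemma l11_abs_subproof (R : realType) (g : l11 R) :
  l11_pred (fun k => `|g k|).
Proof. by apply: (l11_pred_dominated g) => k; rewrite normr_id. Qed.

Definition l11_abs {R : realType} (g : l11 R) := L11 (l11_abs_subproof R g).

Lemma l11_norm_abs (R : realType) (g : l11 R) : `|l11_abs g| = `|g|.
Proof. by apply/eqP; rewrite eq_le !le_l11_norm// => k /=; rewrite normr_id. Qed.

(** After reindexing the norm of [g] by k -> k + s, only the weights differ, and 1 + |k| <= (1 +
    |s|)(1 + |k + s|). The comparison is made on finite subsums. *)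
Lemma l11_enorm_shift (R : realType) (s : int) (g : int -> R) :
  (l11_enorm (fun k => g (k + s)%R) <= (1 + `|s|%:~R)%R%:E * l11_enorm g)%E.
Proof.
have bij : set_bij [set: int] [set: int] (fun k => k + s).
  split => // [x y _ _ /addIr//|y _]; by exists (y - s); rewrite //= subrK.
rewrite [leRHS](_ : _ = (1 + `|s|%:~R)%R%:E *
    \esum_(k in [set: int]) ((1 + `|k + s|%:~R) * `|g (k + s)|)%R%:E)%E; last first.
  congr *%E; exact: (@reindex_esum _ _ _ _ _ _ (fun k => ((1 + `|k|%:~R) * `|g k|)%:E) bij).
apply: ge_ereal_sup => _ [F [finF _]] <-.
have s0 : 0 <= 1 + `|s|%:~R :> R by rewrite addr_ge0 ?ler0z.
apply: (@le_trans _ _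
    ((1 + `|s|%:~R)%R%:E * \sum_(k \in F) ((1 + `|k + s|%:~R) * `|g (k + s)|)%R%:E)%E).
  rewrite ge0_mule_fsumr; last by move=> k; rewrite lee_fin l11_term_ge0.
  apply: lee_fsum => // k _; rewrite -EFinM lee_fin mulrA ler_wpM2r//.
  have : `|k|%:~R <= `|k + s|%:~R + `|s|%:~R :> R.
    by rewrite -intrD ler_int -{1}(addrK s k) ler_normB.
  have : 0 <= `|k + s|%:~R :> R by rewrite ler0z.
  have : 0 <= `|s|%:~R :> R by rewrite ler0z.
  by nra.
by rewrite lee_wpmul2l ?lee_fin//; apply: ereal_sup_ubound; exists F.
Qed.

Lemma l11_shift_subproof (R : realType) (s : int) (g : l11 R) :
  l11_pred (fun k => g (k + s)).
Proof.
apply/asboolP/(le_lt_trans (l11_enorm_shift _ _ _)).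
by rewrite lte_mul_pinfty ?l11_enorm_lty// lee_fin addr_ge0 ?ler0z.
Qed.

Definition l11_shift {R : realType} s (g : l11 R) :=
  L11 (l11_shift_subproof R s g).

Lemma l11_norm_shift (R : realType) (s : int) (g : l11 R) :
  `|l11_shift s g| <= (1 + `|s|%:~R) * `|g|.
Proof. by rewrite -lee_fin EFinM -!l11_enormE l11_enorm_shift. Qed.

Lemma l11_truncate_subproof (R : realType) N (g : l11 R) :
  l11_pred (truncate N g).
Proof.
by apply: (l11_pred_dominated g) => k; rewrite /truncate; case: ifP; rewrite ?normr0.
Qed.

Definition l11_truncate {R : realType} N (g : l11 R) :=
  L11 (l11_truncate_subproof R N g).

Lemma l11_tailE (R : realType) N (g : l11 R) k :
  (g - l11_truncate N g) k = if `|k| <= N%:Z then 0 else g k.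
Proof.
by rewrite l11_addE l11_oppE /= /truncate; case: ifP; rewrite ?subrr ?subr0.
Qed.

Lemma l11_norm_tail_le (R : realType) N (g : l11 R) :
  `|g - l11_truncate N g| <= `|g|.
Proof. by apply: le_l11_norm => k; rewrite l11_tailE; case: ifP; rewrite ?normr0. Qed.

(** A weighted l1 norm is additive on sequences with disjoint supports. *)
Lemma l11_normDtail (R : realType) N (g : l11 R) :
  `|g| = `|l11_truncate N g| + `|g - l11_truncate N g|.
Proof.
apply: EFin_inj; rewrite EFinD -!l11_enormE /l11_enorm -esumD; last 2 first.
  - by move=> k _; rewrite lee_fin l11_term_ge0.
  - by move=> k _; rewrite lee_fin l11_term_ge0.
apply: eq_esum => k _; rewrite -EFinD -mulrDr l11_tailE /= /truncate.
by case: ifP => _; rewrite normr0 ?addr0 ?add0r.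
Qed.

(** Some finite set of indices carries all but e of the norm. Once S_N contains this set, the
    truncation carries at least as much, and by [l11_normDtail] less than e is left for the tail. *)
Lemma l11_truncate_cvg (R : realType) (g : l11 R) (e : R) : 0 < e ->
  \forall N \near \oo, `|g - l11_truncate N g| < e.
Proof.
move=> e0.
have : (`|g|%:E - e%:E < l11_enorm g)%E.
  by rewrite l11_enormE -EFinB lte_fin ltrBlDr ltrDl.
move=> /ereal_sup_gt[_ [F [finF _]] <-] gF.
have [n Fn] : exists n : nat, forall k, F k -> `|k| <= n%:Z.
  have /finite_seqP[r ->] := finF.
  exists (\max_(k <- r) `|k|%N)%N => k /= kr.
  by rewrite -abszE lez_nat; exact: (@leq_bigmax_seq _ _ xpredT (fun k : int => `|k|%N)).
near=> N.
have nN : (n <= N)%N by near: N; exact: nbhs_infty_ge.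
have : (`|g|%:E - e%:E < `|l11_truncate N g|%:E)%E.
  apply: (lt_le_trans gF); rewrite -l11_enormE; apply: ereal_sup_ubound.
  exists F => //; apply: eq_fsbigr => k; rewrite inE => /Fn kn /=.
  by rewrite /truncate (le_trans kn)// lez_nat.
rewrite -EFinB lte_fin {1}(l11_normDtail _ N g); lra.
Unshelve. all: by end_near. Qed.

(** Frees [zsum] from the positive and negative parts in its definition: any decomposition into
    nonnegative summable families computes it. *)
Lemma zsumB (R : realType) (a b : int -> R) :
    (forall l, 0 <= a l) -> (forall l, 0 <= b l) ->
    (\esum_(l in [set: int]) (a l)%:E < +oo)%E ->
    (\esum_(l in [set: int]) (b l)%:E < +oo)%E ->
  zsum (fun l => a l - b l) =
    fine (\esum_(l in [set: int]) (a l)%:E) - fine (\esum_(l in [set: int]) (b l)%:E).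
Proof.
move=> a0 b0 aoo boo.
have smb (c : int -> R) : (forall l, 0 <= c l) ->
    (\esum_(l in [set: int]) (c l)%:E < +oo)%E -> summable setT (EFin \o c).
  by move=> c0; rewrite /summable; apply: le_lt_trans; apply: le_esum => l _ /=;
     rewrite ger0_norm.
have fin (c : int -> R) : (forall l, 0 <= c l) ->
    (\esum_(l in [set: int]) (c l)%:E < +oo)%E ->
    \esum_(l in [set: int]) (c l)%:E \is a fin_num.
  by move=> c0 coo; rewrite ge0_fin_numE// esum_ge0// => l _; rewrite lee_fin.
rewrite /zsum (_ : EFin \o _ = ((EFin \o a) \- (EFin \o b))%E); last first.
  by apply/funext.
rewrite esumB ?fineB ?fin//; try exact: smb.
- by move=> l _; rewrite lee_fin.
- by move=> l _; rewrite lee_fin.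
Qed.

(** The majorant [n] makes the sum of [v] absolutely convergent, so that [zsum] does not fall back
    on a default value; the increment u - v is then controlled by [m] alone. *)
Lemma zsum_dist (R : realType) (u v : int -> R) (m n : l11 R) :
    (forall l, `|v l| <= n l) -> (forall l, `|u l - v l| <= m l) ->
  `|zsum u - zsum v| <= `|m|.
Proof.
move=> vn uvm.
have esumle (c : int -> R) (h : l11 R) : (forall l, `|c l| <= h l) ->
    (\esum_(l in [set: int]) (c l)%:E <= `|h|%:E)%E.
  move=> ch; apply: le_trans (esum_abs_le_l11_norm _ h).
  apply: le_esum => l _; rewrite lee_fin.
  exact: le_trans (ler_norm _) (le_trans (ch l) (ler_norm _)).
have esumlt (c : int -> R) (h : l11 R) : (forall l, `|c l| <= h l) ->
    (\esum_(l in [set: int]) (c l)%:E < +oo)%E.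
  by move=> /esumle/le_lt_trans; apply; rewrite ltry.
pose pos (c : int -> R) l := Num.max (c l) 0.
pose neg (c : int -> R) l := Num.max (- c l) 0.
have pos0 c l : 0 <= pos c l by rewrite /pos le_max lexx orbT.
have neg0 c l : 0 <= neg c l by rewrite /neg le_max lexx orbT.
have posneg c l : c l = pos c l - neg c l.
  by rewrite /pos /neg; case: (leP (c l) 0); case: (leP (- c l) 0); lra.
have posle c (h : l11 R) : (forall l, `|c l| <= h l) -> forall l, `|pos c l| <= h l.
  move=> ch l; rewrite ger0_norm//; apply: le_trans (ch l).
  by rewrite ge_max ler_norm normr_ge0.
have negle c (h : l11 R) : (forall l, `|c l| <= h l) -> forall l, `|neg c l| <= h l.
  move=> ch l; rewrite ger0_norm//; apply: le_trans (ch l).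
  by rewrite ge_max -normrN ler_norm normr_ge0.
pose d l := u l - v l.
pose S (c : int -> R) := fine (\esum_(l in [set: int]) (c l)%:E).
have S_bound c (h : l11 R) : (forall l, 0 <= c l) -> (forall l, `|c l| <= h l) ->
    0 <= S c <= `|h|.
  move=> c0 ch; rewrite fine_ge0/=; last by apply: esum_ge0 => l _; rewrite lee_fin.
  rewrite -lee_fin fineK ?esumle// ge0_fin_numE ?(esumlt _ _ ch)//.
  by apply: esum_ge0 => l _; rewrite lee_fin.
have SD (a b : int -> R) (g h : l11 R) : (forall l, 0 <= a l) -> (forall l, 0 <= b l) ->
    (forall l, `|a l| <= g l) -> (forall l, `|b l| <= h l) ->
    S (fun l => a l + b l) = S a + S b.
  move=> a0 b0 ag bh.
  rewrite /S -fineD ?ge0_fin_numE ?(esumlt _ _ ag) ?(esumlt _ _ bh)//; last 2 first.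
  - by apply: esum_ge0 => l _; rewrite lee_fin.
  - by apply: esum_ge0 => l _; rewrite lee_fin.
  rewrite -esumD; first by congr fine; apply: eq_esum.
  - by move=> l _; rewrite lee_fin.
  - by move=> l _; rewrite lee_fin.
have zv : zsum v = S (pos v) - S (neg v).
  rewrite -zsumB//; first by congr zsum; apply/funext => l; exact: posneg.
  - exact: (esumlt _ n (posle _ _ vn)).
  - exact: (esumlt _ n (negle _ _ vn)).
have dm l : `|d l| <= m l by exact: uvm.
(* This adds the parts of v and of d = u - v. It need not be the canonical decomposition of u, which
   is why [zsumB] is used. The two values of [zsum] then differ by S (pos d) - S (neg d), where both
   terms lie between 0 and the norm of m. *)
have zu : zsum u = (S (pos v) + S (pos d)) - (S (neg v) + S (neg d)).
  rewrite -(SD _ _ n m)//; [|exact: posle|exact: posle].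
  rewrite -(SD _ _ n m)//; [|exact: negle|exact: negle].
  rewrite -zsumB.
  - congr zsum; apply/funext => l.
    by have := posneg v l; have := posneg d l; rewrite {1}/d; lra.
  - by move=> l; rewrite addr_ge0.
  - by move=> l; rewrite addr_ge0.
  - apply: (esumlt _ (n + m)) => l.
    by rewrite l11_addE (le_trans (ler_normD _ _))// lerD// ?posle.
  - apply: (esumlt _ (n + m)) => l.
    by rewrite l11_addE (le_trans (ler_normD _ _))// lerD// ?negle.
have := S_bound _ m (pos0 d) (posle _ _ dm).
have := S_bound _ m (neg0 d) (negle _ _ dm).
by rewrite zu zv ler_norml; lra.
Qed.

(** * Estimates of the collision operator *)

(** Linear in H, which stands for K(a,b) f(a) f(b). A change of f and a change of the kernel are
    thus both treated as a change of H. *)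
Definition collision_sum {R : realType} (H : int -> int -> R) (k : int) : R :=
  zsum (fun l => H l (k - 1) - H k (l - 1) - H l k + H (k + 1) (l - 1)).

(* Dominates, as a sequence in l, the k-th sum defining [collision_sum H]
   whenever H is dominated by the tensor product of u and v. *)
Definition collision_majorant {R : realType} (u v : l11 R) (k : int) : l11 R :=
  (`|v (k - 1)| *: l11_abs u + `|u k| *: l11_shift (-1) (l11_abs v)) +
  (`|v k| *: l11_abs u + `|u (k + 1)| *: l11_shift (-1) (l11_abs v)).

(** Dominates, as a sequence in k, the norms of the sequences [collision_majorant u v k]; its own
    norm therefore controls the double sum over k and l. *)
Definition collision_majorant_bound {R : realType} (u v : l11 R) : l11 R :=
  (`|u| *: l11_shift (-1) (l11_abs v) + (2 * `|v|) *: l11_abs u) +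
  (`|u| *: l11_abs v + (2 * `|v|) *: l11_shift 1 (l11_abs u)).

Lemma le_collision_majorant (R : realType) (H : int -> int -> R) (u v : l11 R) :
  (forall a b, `|H a b| <= `|u a| * `|v b|) -> forall k l,
  `|H l (k - 1) - H k (l - 1) - H l k + H (k + 1) (l - 1)|
    <= collision_majorant u v k l.
Proof.
move=> Huv k l; rewrite /collision_majorant !l11_addE !l11_scaleE /=.
rewrite addrA; apply: le_trans (ler_normD _ _) _; rewrite lerD//.
apply: le_trans (ler_normB _ _) _; rewrite lerD ?[_ * `|u l|]mulrC//.
by apply: le_trans (ler_normB _ _) _; rewrite lerD ?[_ * `|u l|]mulrC.
Qed.

Lemma norm_shift1_abs (R : realType) (s : int) (u : l11 R) : `|s| = 1 ->
  `|l11_shift s (l11_abs u)| <= 2 * `|u|.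
Proof. by move=> s1; rewrite (le_trans (l11_norm_shift _ _ _))// s1 l11_norm_abs. Qed.

Lemma norm_collision_majorant_le (R : realType) (u v : l11 R) k :
  `|collision_majorant u v k| <= collision_majorant_bound u v k.
Proof.
rewrite /collision_majorant_bound !l11_addE !l11_scaleE /=.
have uk : 0 <= `|u k| by []. have uk1 : 0 <= `|u (k + 1)| by [].
have sv := @norm_shift1_abs R (-1) v erefl.
apply: le_trans (ler_normD _ _) _; rewrite lerD//.
all: apply: le_trans (ler_normD _ _) _; rewrite !normrZ !l11_norm_abs !normr_id.
all: by rewrite lerD// mulrC// ler_wpM2r.
Qed.

(** The four terms contribute 2, 2, 1 and 4 to the constant 9: each shift by one costs a factor 2,
    and the last term is shifted in both variables. *)
Lemma norm_collision_majorant_bound (R : realType) (u v : l11 R) :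
  `|collision_majorant_bound u v| <= 9 * (`|u| * `|v|).
Proof.
have sv := @norm_shift1_abs R (-1) v erefl.
have su := @norm_shift1_abs R 1 u erefl.
have u0 : 0 <= `|u| by []. have v0 : 0 <= `|v| by [].
apply: le_trans (ler_normD _ _) _.
have := ler_normD (`|u| *: l11_shift (-1) (l11_abs v)) ((2 * `|v|) *: l11_abs u).
have := ler_normD (`|u| *: l11_abs v) ((2 * `|v|) *: l11_shift 1 (l11_abs u)).
rewrite !normrZ !l11_norm_abs !normr_id normr_nat.
by nra.
Qed.

(** The domination of H' by p and q gives convergence of the sums; the estimate comes from the
    difference. Two tensor products are allowed there because a difference of quadratic expressions
    splits into two products. *)
Lemma collision_sum_dist (R : realType) (H H' : int -> int -> R)
    (p q u v w z : l11 R) :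
    (forall a b, `|H' a b| <= `|p a| * `|q b|) ->
    (forall a b, `|H a b - H' a b| <= `|u a| * `|v b| + `|w a| * `|z b|) ->
  (l11_enorm (fun k => collision_sum H k - collision_sum H' k)%R
    <= (9 * (`|u| * `|v| + `|w| * `|z|))%:E)%E.
Proof.
move=> H'pq HH'.
set D := fun a b => H a b - H' a b.
apply: (@le_trans _ _ `|collision_majorant_bound u v + collision_majorant_bound w z|%:E).
  rewrite -l11_enormE; apply: le_l11_enorm => k.
  rewrite l11_addE [leRHS]ger0_norm; last first.
    by rewrite addr_ge0// (le_trans _ (norm_collision_majorant_le _ _ _ _)).
  apply: (@le_trans _ _ `|collision_majorant u v k + collision_majorant w z k|).
    apply: zsum_dist (le_collision_majorant _ _ _ _ H'pq k) _ => l.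
    rewrite l11_addE /collision_majorant !l11_addE !l11_scaleE /=.
    have := HH' l (k - 1); have := HH' k (l - 1); have := HH' l k.
    have := HH' (k + 1) (l - 1).
    rewrite !ler_norml; lra.
  by rewrite (le_trans (ler_normD _ _))// lerD ?norm_collision_majorant_le.
rewrite lee_fin (le_trans (ler_normD _ _))// mulrDr.
by rewrite lerD ?norm_collision_majorant_bound.
Qed.

Lemma collisionE (R : realType) (K : int -> int -> R) (f : int -> R) :
  collision K f = collision_sum (fun a b => K a b * f a * f b).
Proof. by []. Qed.

Lemma collision_lipschitz (R : realType) (K : int -> int -> R) (C : R)
    (f g : l11 R) : (forall k l, `|K k l| <= C) ->
  (l11_enorm (fun k => collision K f k - collision K g k)%R
    <= (9 * C * (`|f| + `|g|) * `|f - g|)%:E)%E.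
Proof.
move=> KC; have C0 : 0 <= C := le_trans (normr_ge0 _) (KC 0 0).
apply: (@le_trans _ _ (9 * (`|C *: f| * `|f - g| + `|C *: (f - g)| * `|g|))%:E).
  rewrite !collisionE; apply: (@collision_sum_dist _ _ _ (C *: g) g) => a b.
    by rewrite l11_scaleE !normrM (ger0_norm C0) !ler_wpM2r.
  rewrite !l11_scaleE !l11_addE !l11_oppE !normrM (ger0_norm C0).
  (* Each of the two tensor products has one factor f - g, which yields the factor |f| + |g| in the
     Lipschitz constant. *)
  rewrite (_ : _ - _ = K a b * (f a * (f b - g b) + (f a - g a) * g b)); last by ring.
  rewrite normrM -!mulrA -mulrDr ler_pM// (le_trans (ler_normD _ _))//.
  by rewrite !normrM.
by rewrite lee_fin !normrZ (ger0_norm C0) le_eqVlt; apply/orP; left; apply/eqP; ring.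
Qed.

Lemma collision_truncate_kernel (R : realType) (K : int -> int -> R) (C : R)
    (f : l11 R) N : (forall k l, `|K k l| <= C) -> (0 < N)%N ->
  (l11_enorm (fun k => collision (truncate_kernel N K) f k - collision K f k)%R
    <= (18 * C * `|f| * `|f - l11_truncate N.-1 f|)%:E)%E.
Proof.
move=> KC N0; have C0 : 0 <= C := le_trans (normr_ge0 _) (KC 0 0).
set r := f - l11_truncate N.-1 f.
apply: (@le_trans _ _ (9 * (`|C *: r| * `|f| + `|C *: f| * `|r|))%:E).
  rewrite !collisionE; apply: (@collision_sum_dist _ _ _ (C *: f) f) => a b.
    by rewrite l11_scaleE !normrM (ger0_norm C0) !ler_wpM2r.
  rewrite !l11_scaleE !normrM (ger0_norm C0) /truncate_kernel.
  case: ifPn => ab; first by rewrite subrr normr0 addr_ge0// !mulr_ge0.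
  rewrite !mul0r sub0r normrN !normrM.
  (* The two index ranges of the truncated kernel are shifted against each other; both contain
     S_{N-1} but not S_N. Where the kernel is cut off, at least one index therefore lies outside
     S_{N-1}, and the corresponding factor can be replaced by the tail r. *)
  have {ab} : (`|a| <= N.-1%:Z) && (`|b| <= N.-1%:Z) = false.
    by apply: contraNF ab; lia.
  rewrite !l11_tailE; case: ifP => _ /=; last first.
    by rewrite ler_wpDr ?mulr_ge0// !ler_wpM2r.
  by move=> ->; rewrite ler_wpDl ?mulr_ge0// !ler_wpM2r.
by rewrite lee_fin !normrZ (ger0_norm C0) le_eqVlt; apply/orP; left; apply/eqP; ring.
Qed.

Lemma truncate_kernel_le (R : realType) (K : int -> int -> R) (C : R) N :
  (forall k l, `|K k l| <= C) -> forall k l, `|truncate_kernel N K k l| <= C.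
Proof.
move=> KC k l; rewrite /truncate_kernel; case: ifP => // _.
by rewrite normr0 (le_trans _ (KC 0 0)).
Qed.

(** * Difference quotients and a comparison principle *)

Lemma diffqB (R : realType) (V : normedModType R) (f g : R -> V) t s :
  diffq (fun x => g x - f x) t s = diffq g t s - diffq f t s.
Proof. by rewrite /diffq -scalerBr; congr (_ *: _); rewrite !opprB addrACA [- _ + _]addrC addrACA. Qed.

(** For s different from t, f(s) is f(t) plus (s - t) times a convergent quotient. The point s = t,
    excluded from the quotients but not from the claim, is treated separately. *)
Lemma derivable_on_continuous (R : realType) (V : normedModType R) (A : set R)
    (f : R -> V) (t : R) :
  derivable_on A f t -> f s @[s --> within A (nbhs t)] --> f t.
Proof.
rewrite /derivable_on => df.
have : (s - t) *: diffq f t s + f t @[s --> within A t^'] --> 0 *: lim (diffq f t s @[s --> within A t^']) + f t.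
  apply: cvgD; last exact: cvg_cst.
  apply: cvgZ => //.
  have At : within A t^' --> t.
    by apply: (cvg_trans (cvg_within _)); exact: cvg_within.
  by rewrite -(subrr t); apply: cvgB; [exact: At|exact: cvg_cst].
rewrite scale0r add0r => cf P Pft.
have H : \forall s \near t, s != t -> A s -> P ((s - t) *: diffq f t s + f t).
  exact: cf Pft.
suff : \forall s \near t, A s -> P (f s) by [].
apply: filterS H => s H As.
have [->|st] := eqVneq s t; first exact: nbhs_singleton.
have := H st As; rewrite /diffq scalerA divff ?subr_eq0// scale1r subrK.
by [].
Qed.

Lemma derivable_on_within_continuous (R : realType) (V : normedModType R)
    (A B : set R) (f : R -> V) : B `<=` A ->
  (forall t, A t -> derivable_on A f t) -> {within B, continuous f}.
Proof.
move=> BA df; apply/subspace_continuousP => t /BA/df/derivable_on_continuous.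
by apply: cvg_trans; apply: cvg_app; exact: within_subset.
Qed.

Lemma at_left_sub_within (R : realType) (A : set R) (a t : R) : a < t ->
  (forall s, a < s < t -> A s) -> t^'- --> within A t^'.
Proof.
move=> at_ As P PA.
have H : \forall s \near t, s != t -> A s -> P s by exact: PA.
have at' : \forall s \near t, a < s by exact: lt_nbhsr.
suff : \forall s \near t, s < t -> P s by [].
apply: filterS2 at' H => s las H lst; apply: H; first by rewrite lt_eqF.
by apply: As; rewrite las.
Qed.

Lemma at_right_sub_within (R : realType) (A : set R) (t b : R) : t < b ->
  (forall s, t < s < b -> A s) -> t^'+ --> within A t^'.
Proof.
move=> tb As P PA.
have H : \forall s \near t, s != t -> A s -> P s by exact: PA.
have tb' : \forall s \near t, s < b by exact: lt_nbhsl.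
suff : \forall s \near t, t < s -> P s by [].
apply: filterS2 tb' H => s lsb H lts; apply: H; first by rewrite gt_eqF.
by apply: As; rewrite lsb lts.
Qed.

(** Properness makes [derive_on] on a compact interval computable from a convergence statement.
    Every point is approached from the left, except the left endpoint, which is approached from the
    right. *)
Lemma within_itv_dnbhs_proper (R : realType) (a b t : R) : a < b ->
  t \in `[a, b] -> ProperFilter (within `[a, b] t^').
Proof.
move=> ab; rewrite in_itv/= => /andP[a_t tb]; split.
  have [at_|] := ltP a t.
    move=> /(at_left_sub_within R `[a, b] a t at_) H.
    apply: (@filter_not_empty _ (t^'-)); apply: H => s /= /andP[sa st].
    by rewrite in_itv/= (ltW sa) (le_trans (ltW st)).
  move=> ta; have tb' : t < b by exact: le_lt_trans ab.
  move=> /(at_right_sub_within R `[a, b] t b tb') H.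
  apply: (@filter_not_empty _ (t^'+)); apply: H => s /= /andP[sa st].
  by rewrite in_itv/= (ltW st) (le_trans a_t (ltW sa)).
exact: within_filter.
Qed.

(* At the first time where |e| = phi the left difference quotients of |e| are
   at least those of phi, while being bounded in the limit by |e'|. *)
Lemma norm_lt_comparison (R : realType) (V : normedModType R) (T : R)
    (e : R -> V) (phi : R -> R) :
    (forall t, t \in `[0, T] -> e s @[s --> within `[0, T] (nbhs t)] --> e t) ->
    continuous phi -> `|e 0| < phi 0 ->
    (forall t, 0 < t <= T -> `|e t| = phi t -> exists d c,
      [/\ diffq e t s @[s --> t^'-] --> d, diffq phi t s @[s --> t^'-] --> c
        & `|d| < c]) ->
  forall t, t \in `[0, T] -> `|e t| < phi t.
Proof.
move=> ec phic e0 econ t1 t1T; rewrite ltNge; apply/negP => et1.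
pose S := [set t | t \in `[0, T] /\ phi t <= `|e t|].
have Sinf : has_inf S.
  split; first by exists t1.
  by exists 0 => t [] /=; rewrite in_itv/= => /andP[].
pose t0 := inf S.
have lbS t : S t -> t0 <= t by move=> St; apply: (ge_inf Sinf.2).
have t0ge0 : 0 <= t0.
  by apply: lb_le_inf Sinf.1 _ => t []; rewrite in_itv/= => /andP[].
have t0T : t0 \in `[0, T].
  rewrite in_itv/= t0ge0; apply: le_trans (lbS t1 _) _ => //.
  by move: t1T; rewrite in_itv/= => /andP[].
have hc : `|e s| - phi s @[s --> within `[0, T] (nbhs t0)] --> `|e t0| - phi t0.
  apply: cvgB; first by apply: cvg_norm; exact: ec.
  by apply: cvg_within_filter; exact: phic.
(* The infimum is attained: otherwise |e| - phi would be negative on a neighbourhood of t0 in the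
   interval, which contains elements of S. *)
have St0 : phi t0 <= `|e t0|.
  rewrite leNgt; apply/negP; rewrite -subr_lt0 => h0.
  have /nbhs_ballP[d /= d0 Hd] :
      nbhs t0 [set s | s \in `[0, T] -> `|e s| - phi s < 0].
    exact: (cvgr_lt _ hc _ h0).
  have [s [sT hs] st] := inf_adherent d0 Sinf.
  suff /Hd/(_ sT) : ball t0 d s by rewrite /= subr_lt0 ltNge hs.
  by rewrite /ball /= ler0_norm ?subr_le0 ?lbS// opprB ltrBlDl.
have t0gt0 : 0 < t0.
  rewrite lt_neqAle t0ge0 andbT; apply/eqP => t00.
  by move: St0; rewrite -t00 leNgt e0.
have tT : t0 <= T by move: t0T; rewrite in_itv/= => /andP[].
have before s : 0 < s < t0 -> `|e s| < phi s.
  move=> /andP[s0 st]; rewrite ltNge; apply/negP => hs.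
  have : t0 <= s by apply: lbS; split => //; rewrite in_itv/= (ltW s0) (le_trans (ltW st)).
  by rewrite leNgt st.
have near_before : \forall s \near t0^'-, 0 < s < t0.
  near=> s; apply/andP; split; first by near: s; exact: nbhs_left_gt.
  by near: s; exact: nbhs_left_lt.
have eq0 : `|e t0| = phi t0.
  apply/eqP; rewrite eq_le St0 andbT -subr_le0.
  have hcl : `|e s| - phi s @[s --> t0^'-] --> `|e t0| - phi t0.
    apply: cvg_trans hc; apply: cvg_app.
    have sub s : 0 < s < t0 -> s \in `[0, T].
      by move=> /andP[s0 st]; rewrite in_itv/= (ltW s0) (le_trans (ltW st)).
    move=> P PT; apply: (at_left_sub_within R `[0, T] 0 t0 t0gt0 sub).
    have {}PT : \forall s \near t0, s \in `[0, T] -> P s by exact: PT.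
    suff : \forall s \near t0, s != t0 -> s \in `[0, T] -> P s by [].
    by apply: filterS PT => s Ps _.
  apply: (cvgr_to_le hcl); apply: filterS near_before => s /before.
  by rewrite subr_le0 => /ltW.
have [d [c [de dphi]]] := econ _ (introT andP (conj t0gt0 tT)) eq0.
apply/negP; rewrite -leNgt.
apply: (ler_cvg_to dphi (cvg_norm de)).
apply: filterS near_before => s /[dup] /before es /andP[_ st].
rewrite /diffq normrZ normfV.
rewrite (_ : `|s - t0| = t0 - s); last by rewrite ltr0_norm ?subr_lt0// opprB.
rewrite -[s - t0]opprB invrN scaleNr -scalerN opprB /GRing.scale /=.
rewrite ler_wpM2l ?invr_ge0 ?subr_ge0 ?(ltW st)//.
(* As |e(s)| < phi(s) with equality at t0, the increment of phi from s to t0 is at most that of |e|,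
   hence at most |e(t0) - e(s)|. *)
rewrite -eq0; apply: (@le_trans _ _ (`|e t0| - `|e s|)); first by rewrite lerD2l lerN2 ltW.
by rewrite distrC; exact: lerB_dist.
Unshelve. all: by end_near. Qed.

Lemma cvg_diffq (R : realType) (V : normedModType R) (f : R -> V) (t : R) (d : V) :
  is_derive t 1 f d -> diffq f t s @[s --> t^'] --> d.
Proof.
move=> [df fd] P Pd.
have : h^-1 *: (f (h *: 1 + t) - f t) @[h --> 0^'] --> d by rewrite -fd; exact: df.
move=> /(_ P Pd) H.
have {}H : \forall h \near 0, h != 0 -> P (h^-1 *: (f (h *: 1 + t) - f t)) by [].
suff : \forall s \near t, s != t -> P (diffq f t s) by [].
rewrite (near_shift 0 t) subr0; apply: filterS H => h /= H.
rewrite -[X in _ != X]add0r (inj_eq (addIr _)) => /H.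
by rewrite /diffq addrK /GRing.scale /= mulr1.
Qed.

(** Needed because the equations differentiate within [0, +oo[ and the C1 norm within [0, T]: at T
    the quotients of the latter are one-sided. *)
Lemma derive_on_diff (R : realType) (V : normedModType R) (A B : set R)
    (f g : R -> V) t : ProperFilter (within B t^') -> B `<=` A ->
    derivable_on A f t -> derivable_on A g t ->
  derive_on B (fun s => g s - f s) t = derive_on A g t - derive_on A f t.
Proof.
move=> PB BA df dg; apply: cvg_lim; first exact: norm_hausdorff.
rewrite (_ : diffq _ t = fun s => diffq g t s - diffq f t s); last first.
  by apply/funext => s; exact: diffqB.
have BAt : within B t^' --> within A t^' by exact: within_subset.
by apply: cvgB; apply: (cvg_trans _ (dg)) || apply: (cvg_trans _ df); apply: cvg_app.
Qed.

(** * Stability of solutions *)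

(** Inserting Q'(f) between Q'(g) and Q(f) leaves a Lipschitz term for the new kernel and a kernel
    error at f only, so that no information on the tails of g is required. The factor 1 + 2M bounds
    |f| + |g|. *)
Lemma collision_dist (R : realType) (K K' : int -> int -> R) (C M e : R)
    (f g df dg : l11 R) :
    (forall k l, `|K' k l| <= C) -> `|f| <= M -> `|g - f| <= 1 ->
    (l11_enorm (fun k => collision K' f k - collision K f k)%R <= e%:E)%E ->
    df = collision K f :> (int -> R) -> dg = collision K' g :> (int -> R) ->
  `|dg - df| <= 9 * C * (1 + 2 * M) * `|g - f| + e.
Proof.
move=> KC fM gf1 Ke dfE dgE; have C0 : 0 <= C := le_trans (normr_ge0 _) (KC 0 0).
rewrite -lee_fin -l11_enormE.
rewrite (_ : (dg - df : int -> R) =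
    (fun k => collision K' g k - collision K' f k) +
    (fun k => collision K' f k - collision K f k)); last first.
  by apply/funext => k; rewrite l11_addE l11_oppE dfE dgE /= addrA subrK.
apply: le_trans (l11_enormD _ _) _; rewrite EFinD leeD//.
apply: le_trans (collision_lipschitz _ _ C _ _ KC) _; rewrite lee_fin.
rewrite ler_wpM2r// ler_wpM2l ?mulr_ge0//.
by have := ler_distD 0 g f; have := lerB_dist g f; lra.
Qed.

Section stability.
Variables (R : realType) (K K' : int -> int -> R) (C M T e : R).
Variables (f0 g0 : int -> R) (f g : R -> l11 R).
Hypothesis K'C : forall k l, `|K' k l| <= C.
Hypothesis f_sol : is_solution K f0 f.
Hypothesis g_sol : is_solution K' g0 g.
Hypothesis T0 : 0 < T.
Hypothesis fM : forall t, t \in `[0, T] -> `|f t| <= M.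
Hypothesis gf0 : `|g 0 - f 0| < e.
Hypothesis Ke : forall t, t \in `[0, T] ->
  (l11_enorm (fun k => collision K' (f t) k - collision K (f t) k)%R <= e%:E)%E.

Let L := 9 * C * (1 + 2 * M).
Let E := expR ((L + 1) * T).
Hypothesis eE : e * E <= 1.

Let C0 : 0 <= C := le_trans (normr_ge0 _) (K'C 0 0).
Let M0 : 0 <= M.
Proof. by apply: le_trans (fM 0 _); rewrite // in_itv/= lexx ltW. Qed.
Let L0 : 0 <= L. Proof. by rewrite /L !mulr_ge0// addr_ge0// mulr_ge0. Qed.
Let e0 : 0 < e. Proof. exact: le_lt_trans gf0. Qed.

Let phi t := e * expR ((L + 1) * t).

Let phi_le t : t <= T -> phi t <= e * E.
Proof. by move=> tT; rewrite ler_wpM2l ?(ltW e0)// /E ler_expR ler_wpM2l// addr_ge0. Qed.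

Let is_derive_phi t : is_derive (t : R) (1 : R) phi ((L + 1) * phi t).
Proof.
rewrite /phi; apply: is_derive_eq.
rewrite /GRing.scale /=; ring.
Qed.

Let itv_ge0 t : t \in `[0, T] -> [set` `[0, +oo[] t.
Proof. by rewrite /= !in_itv/= => /andP[->]. Qed.

Lemma solution_dist t : t \in `[0, T] -> `|g t - f t| <= e * E.
Proof.
move=> tT; have [fC1 fE fi] := f_sol; have [gC1 gE gi] := g_sol.
apply: (@le_trans _ _ (phi t)); last first.
  by apply: phi_le; move: tT; rewrite in_itv/= => /andP[].
apply/ltW; move: t tT.
apply: (@norm_lt_comparison _ _ T (fun t => g t - f t) phi) => [s sT|s||s /andP[s0 sT] eqphi].
- have cont (h : R -> l11 R) : C1_on `[0, +oo[ h ->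
      h u @[u --> within `[0, T] (nbhs s)] --> h s.
    move=> [dh _].
    have /subspace_continuousP := derivable_on_within_continuous _ _ _ _ _ itv_ge0 dh.
    exact.
  by apply: cvgB; exact: cont.
- apply: differentiable_continuous; apply/derivable1_diffP.
  exact: (@ex_derive _ _ _ _ _ _ _ (is_derive_phi s)).
- by rewrite /phi mulr0 expR0 mulr1.
have sTT : s \in `[0, T] by rewrite in_itv/= (ltW s0).
have left_cvg (h : R -> l11 R) : C1_on `[0, +oo[ h ->
    diffq h s u @[u --> s^'-] --> derive_on `[0, +oo[ h s.
  have sub u : 0 < u < s -> [set` `[0, +oo[] u.
    by move=> /andP[u0 _]; rewrite /= in_itv/= (ltW u0).
  move=> [dh _]; apply: cvg_trans (dh s (itv_ge0 _ sTT)); apply: cvg_app.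
  exact: (at_left_sub_within _ _ _ _ s0 sub).
exists (derive_on `[0, +oo[ g s - derive_on `[0, +oo[ f s), ((L + 1) * phi s); split.
- rewrite (_ : diffq _ s = fun u => diffq g s u - diffq f s u); last first.
    by apply/funext => u; exact: diffqB.
  by apply: cvgB; exact: left_cvg.
- apply: cvg_trans (cvg_diffq _ _ _ _ _ (is_derive_phi s)); apply: cvg_app.
  move=> P Ps; have {}Ps : \forall u \near s, u != s -> P u by exact: Ps.
  suff : \forall u \near s, u < s -> P u by [].
  by apply: filterS Ps => u Pu us; apply: Pu; rewrite lt_eqF.
(* At a touching time the distance equals the barrier, which [eE] keeps below 1; this is what admits
   the local estimate [collision_dist]. *)
have le1 : `|g s - f s| <= 1 by rewrite eqphi (le_trans (phi_le _ sT)).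
apply: le_lt_trans (collision_dist _ _ _ _ _ _ _ _ _ _ K'C (fM _ sTT) le1 (Ke _ sTT)
  (fE _ s0) (gE _ s0)) _.
(* The surplus 1 in the rate L + 1 provides an extra phi(s), which strictly exceeds the error e at
   positive times. *)
have ep : e < phi s by rewrite /phi ltr_pMr// expR_gt1 mulr_gt0// ltr_wpDl.
by rewrite eqphi -/L [ltRHS]mulrDl mul1r ltrD2l.
Qed.

(** At positive times the equations and [solution_dist] give L (e E) + e. At time 0 the equations
    are not assumed, and the bound passes to the limit by continuity of the derivatives. *)
Lemma solution_derive_dist t : t \in `[0, T] ->
  `|derive_on `[0, +oo[ g t - derive_on `[0, +oo[ f t| <= (L * E + 1) * e.
Proof.
move=> tT; have [fC1 fE fi] := f_sol; have [gC1 gE gi] := g_sol.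
have pos s : 0 < s -> s \in `[0, T] ->
    `|derive_on `[0, +oo[ g s - derive_on `[0, +oo[ f s| <= (L * E + 1) * e.
  move=> s0 sT; have gf := solution_dist s sT.
  apply: le_trans (collision_dist _ _ _ _ _ _ _ _ _ _ K'C (fM _ sT)
    (le_trans gf eE) (Ke _ sT) (fE _ s0) (gE _ s0)) _.
  rewrite -/L mulrDl mul1r lerD2r -mulrA [E * e]mulrC.
  by rewrite ler_wpM2l.
have [t0|] := ltP 0 t; first exact: pos.
move: (tT); rewrite in_itv/= => /andP[t_ge0 _] t_le0.
have {t_ge0 t_le0 tT} -> : t = 0 by apply/eqP; rewrite eq_le t_ge0 t_le0.
have right_cvg (h : R -> l11 R) : C1_on `[0, +oo[ h ->
    derive_on `[0, +oo[ h u @[u --> 0^'+] --> derive_on `[0, +oo[ h 0.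
  move=> [_ /subspace_continuousP dh].
  have A0 : [set` `[0, +oo[] (0 : R) by rewrite /= in_itv/= lexx.
  apply: cvg_trans (dh 0 A0); apply: cvg_app => P PA.
  have {}PA : \forall s \near (0 : R), s \in `[0, +oo[ -> P s by exact: PA.
  suff : \forall s \near (0 : R), 0 < s -> P s by [].
  by apply: filterS PA => s Ps s0; apply: Ps; rewrite in_itv/= ltW.
apply: (cvgr_to_le (cvg_norm (cvgB (right_cvg _ gC1) (right_cvg _ fC1)))).
near=> s; apply: pos; first by near: s; exact: nbhs_right_gt.
rewrite in_itv/=; apply/andP; split; near: s; [exact: nbhs_right_ge|exact: nbhs_right_le].
Unshelve. all: by end_near. Qed.

Lemma C1norm_solution_dist :
  (C1norm_on `[0%R, T] (fun t => g t - f t)%R <= (e * E + (L * E + 1) * e)%:E)%E.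
Proof.
have [[fC1 _] _ _] := f_sol; have [[gC1 _] _ _] := g_sol.
rewrite EFinD; apply: leeD.
  by apply: ge_ereal_sup => _ [t tT] <-; rewrite lee_fin solution_dist.
apply: ge_ereal_sup => _ [t tT] <-; rewrite lee_fin.
have prop := within_itv_dnbhs_proper _ _ _ _ T0 tT.
rewrite (@derive_on_diff _ _ [set` `[0, +oo[] _ _ _ _ prop itv_ge0 (fC1 _ (itv_ge0 _ tT))
  (gC1 _ (itv_ge0 _ tT))).
exact: solution_derive_dist.
Qed.

End stability.

(** * Uniformly small tails along a solution, and convergence of the truncated problems *)

Lemma l11_norm_tail_dist (R : realType) N (g h : l11 R) :
  `|g - l11_truncate N g| <= `|g - h| + `|h - l11_truncate N h|.
Proof.
rewrite (_ : g - l11_truncate N g =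
    (g - h - l11_truncate N (g - h)) + (h - l11_truncate N h)).
  by rewrite (le_trans (ler_normD _ _))// lerD2r l11_norm_tail_le.
apply/val_inj/funext => k; rewrite [RHS]l11_addE [LHS]l11_tailE !l11_tailE.
by case: ifP => _; rewrite ?addr0// l11_addE l11_oppE subrK.
Qed.

Lemma supnorm_on_ge0 (R : realType) (V : normedModType R) (A : set R)
    (u : R -> V) (t : R) : A t -> (0 <= supnorm_on A u)%E.
Proof.
move=> At; apply: (@le_trans _ _ `|u t|%:E); first by rewrite lee_fin.
by apply: ereal_sup_ubound; exists t.
Qed.

(** Near a fixed t the tail of f(s) is at most that of f(t) plus |f(s) - f(t)|, so one N works on a
    neighbourhood; compactness of the interval makes this uniform. *)
Lemma l11_truncate_cvg_uniform (R : realType) (T e : R) (f : R -> l11 R) :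
    {within `[0, T], continuous f} -> 0 < e ->
  \forall N \near \oo, forall t, t \in `[0, T] ->
    `|f t - l11_truncate N (f t)| < e.
Proof.
move=> /subspace_continuousP fc e0.
have /compact_near_coveringP/near_covering_withinP cpt := @segment_compact R 0 T.
apply: (cpt nat \oo (fun N t => `|f t - l11_truncate N (f t)| < e)) => t tT.
have e20 : 0 < e / 2 by rewrite divr_gt0.
have /cvgrPdist_lt/(_ _ e20) ft := fc t tT.
have {}ft : \forall s \near t, s \in `[0, T] -> `|f t - f s| < e / 2 by exact: ft.
exists ([set s | s \in `[0, T] -> `|f t - f s| < e / 2],
        [set N | `|f t - l11_truncate N (f t)| < e / 2]).
  by split => //; exact: l11_truncate_cvg.
move=> [s N] /= [fs tN] sT; rewrite (splitr e).
by rewrite (le_lt_trans (l11_norm_tail_dist _ _ _ (f t)))// ltrD// distrC fs.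
Qed.

Theorem theorem4p1 (R : realType) (K : int -> int -> R) (CK : R)
    (K_ge0 : forall k l, 0 <= K k l)
    (CK_gt0 : 0 < CK) (K_le : forall k l, K k l <= CK)
    (f0 : l11 R) (f0_ge0 : forall k, 0 <= f0 k)
    (f : R -> l11 R) (f_sol : is_solution K f0 f)
    (fN : nat -> R -> l11 R)
    (fN_sol : forall N : nat,
      is_solution (truncate_kernel N K) (truncate N f0) (fN N))
    (T : R) (T_gt0 : 0 < T) :
  C1norm_on `[0, T] (fun t => fN N t - f t) @[N --> \oo] --> 0%E.
Proof.
have KC k l : `|K k l| <= CK by rewrite ger0_norm.
have [fC1 _ fi] := f_sol.
have fc : {within `[0, T], continuous f}.
  apply: derivable_on_within_continuous _ fC1.1 => t.
  by rewrite /= !in_itv/= => /andP[->].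
have [M M0 fM] : exists2 M, 0 <= M & forall t, t \in `[0, T] -> `|f t| <= M.
  have nfc : {within `[0, T], continuous (fun t => `|f t|)}.
    apply/subspace_continuousP => t tT; apply: cvg_norm.
    exact: (iffLR (subspace_continuousP _ _) fc).
  have [c _ fc_max] := EVT_max (ltW T_gt0) nfc.
  by exists `|f c|.
pose L := 9 * CK * (1 + 2 * M).
pose E := expR ((L + 1) * T).
have L0 : 0 <= L by rewrite /L !mulr_ge0// ?addr_ge0// ?mulr_ge0// ltW.
have E0 : 0 < E := expR_gt0 _.
have small d : 0 < d -> d * E <= 1 -> \forall N \near \oo,
    (C1norm_on `[0%R, T] (fun t => fN N t - f t)%R <= (d * E + (L * E + 1) * d)%:E)%E.
  move=> d0 dE.
  (* Tails below d divided by this number make the kernel error at most d; the summand 1 keeps the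
     divisor positive when M = 0. *)
  have B0 : 0 < 18 * CK * M + 1 by rewrite ltr_pwDr// !mulr_ge0// ltW.
  have [N0 _ tails] := l11_truncate_cvg_uniform _ _ _ _ fc (divr_gt0 d0 B0).
  near=> N.
  (* The kernel error involves the tail beyond N - 1, so N - 1 has to reach N0. *)
  have N1 : (N0.+1 <= N)%N by near: N; exact: nbhs_infty_ge.
  have Ngt0 : (0 < N)%N by exact: leq_trans N1.
  apply: (@C1norm_solution_dist _ K _ CK M T d _ _ f (fN N)
    (truncate_kernel_le _ _ _ _ KC) f_sol (fN_sol N)) => //.
    have [_ _ fNi] := fN_sol N.
    rewrite distrC (_ : f 0 - fN N 0 = f0 - l11_truncate N f0).
      near: N; exact: l11_truncate_cvg.
    apply/val_inj/funext => k.
    by rewrite [LHS]l11_addE [RHS]l11_addE !l11_oppE fi fNi.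
  move=> t tT; apply: le_trans (collision_truncate_kernel _ _ _ _ _ KC Ngt0) _.
  have /(_ N.-1)/= := tails; rewrite -ltnS prednK// => /(_ N1 t tT).
  rewrite ltr_pdivlMr// lee_fin => /ltW; apply: le_trans.
  by rewrite mulrC ler_wpM2l// ler_wpDr// ler_wpM2l ?fM// mulr_ge0// (ltW CK_gt0).
have C1norm0 N : (0 <= C1norm_on `[0%R, T] (fun t => fN N t - f t)%R)%E.
  have mem0 : [set` `[0, T]] (0 : R) by rewrite /= in_itv/= lexx ltW.
  by apply: adde_ge0; exact: supnorm_on_ge0 mem0.
have near_le e : 0 < e -> \forall N \near \oo,
    (C1norm_on `[0%R, T] (fun t => fN N t - f t)%R <= e%:E)%E.
  move=> e0.
  have D0 : 0 < (L + 1) * E + 1 by rewrite ltr_pwDr// mulr_ge0 ?ltW// ltr_wpDl.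
  (* Chosen so that the bound of [small], which is d times this denominator, equals min(1, e). The
     minimum with 1 ensures d E <= 1. *)
  pose d := Num.min 1 e / ((L + 1) * E + 1).
  have m0 : 0 < Num.min 1 e by rewrite lt_min ltr01.
  have dD : d * ((L + 1) * E + 1) = Num.min 1 e by rewrite divfK// gt_eqF.
  have d0 : 0 < d by rewrite divr_gt0.
  have dE : d * E <= 1.
    have : Num.min 1 e <= 1 by rewrite ge_min lexx.
    have : 0 <= d * (L * E) by rewrite (mulr_ge0 (ltW d0))// (mulr_ge0 L0)// ltW.
    by rewrite -dD; lra.
  apply: filterS (small d d0 dE) => N /le_trans; apply; rewrite lee_fin.
  rewrite (_ : _ + _ = Num.min 1 e) ?ge_min ?lexx ?orbT// -dD; ring.
apply/fine_cvgP; split.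
  apply: filterS (near_le 1 ltr01) => N H; rewrite ge0_fin_numE//.
  exact: le_lt_trans H (ltry _).
apply/cvgrPdist_le => e e0; apply: filterS (near_le e e0) => N H.
rewrite sub0r normrN ger0_norm ?fine_ge0//.
rewrite -lee_fin fineK// ge0_fin_numE//.
exact: le_lt_trans H (ltry _).
Unshelve. all: by end_near. Qed.
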